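(* Let $\mathcal{H}=\{H_1,\dots,H_m\}$ be a finite nonempty family of tournaments each of which contains a tournament $H$ as a subtournament, and assume $\mathcal{H}$ has the $(\mathcal{F},v,\eta)$-strong EH-property. Then $\mathcal{H}$ has the EH-property, and hence $H$ satisfies the Erdős–Hajnal Conjecture, i.e. there is $\epsilon(H)>0$ such that every tournament $T$ not containing $H$ as a subtournament contains a transitive subtournament on at least $|T|^{\epsilon(H)}$ vertices.
   Context: Tournaments are finite; a subtournament is an induced subtournament on a subset of vertices; a tournament is transitive if it has no directed cycle. For a tournament $T$, $tr(T)$ is the maximum size of a transitive subtournament of $T$. A set $V_1$ is complete to $V_2$ if every vertex of $V_1$ has an edge to every vertex of $V_2$. For disjoint nonempty $X,Y\subseteq V(T)$, $d(X,Y)=e_{X,Y}/(|X||Y|)$ where $e_{X,Y}$ is the number of edges $(x,y)$ with $x\in X,y\in Y$. For a $\{0,1\}$-vector $v$ of length $m'$, let $\zeta^v(i)=|\{j\le i: v(j)=1\}|$. Let $\eta$ be a vector of positive integers of length $\zeta^v(m')$ and $k=|\{j:v(j)=0\}|+\sum_i \eta(i)$. For a tournament $T$, $c>0$, $0\le\lambda<1$, a $(v,\eta,c,\lambda)$-m-sequence in $T$ is a sequence $\chi=(S_1,\dots,S_{m'})$ of pairwise disjoint subsets of $V(T)$ such that: if $v(i)=1$ then $S_i$ induces a transitive subtournament and is partitioned into $\eta(\zeta^v(i))$ sets $S_{i,1},\dots,S_{i,\eta(\zeta^v(i))}$ with $S_{i,a}$ complete to $S_{i,b}$ for $a<b$ and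 $|S_{i,a}|\ge c\,tr(T)$ for all $a$; if $v(i)=0$ then $|S_i|\ge c|T|$; and $d(S_i,S_j)\ge 1-\lambda$ for all $i<j$. Its long representation $l(\chi)=(T_1,\dots,T_k)$ is obtained by replacing each $S_i$ with $v(i)=1$ by $S_{i,1},\dots,S_{i,\eta(\zeta^v(i))}$ in order; $V(\chi)=\bigcup S_i$. A $c'$-strong pair in $\chi$ is a pair $(A,B)$ of disjoint subsets of $V(\chi)$ with $|A|\ge c'|T|$, such that either $|B|\ge c'|T|$ or ($B$ induces a transitive subtournament and $|B|\ge c'\,tr(T)$), and $d(A,B)=1$ or $d(B,A)=1$. With $V(H_i)=\{h^i_1,\dots,h^i_{|H_i|}\}$ and $\mathcal{F}=\{f_1,\dots,f_m\}$, $f_i:V(H_i)\to\{1,\dots,k\}$ injective, $\mathcal{H}$ has the $(\mathcal{F},v,\eta)$-strong EH-property if for every $c_1>0$ there exist $\lambda_0>0$, $c_2>0$ such that for every tournament $T$, every $0\le\lambda\le\lambda_0$ and every $(v,\eta,c_1,\lambda)$-m-sequence $\chi$ in $T$ with $l(\chi)=(T_1,\dots,T_k)$, either there exist $i$ and vertices $x_j\in T_{f_i(h^i_j)}$ ($1\le j\le|H_i|$) such that $x_j\mapsto h^i_j$ is an isomorphism from the subtournament induced on $\{x_1,\dots,x_{|H_i|}\}$ onto $H_i$, or $\chi$ contains a $c_2$-strong pair. A finite family $\mathcal{H}$ has the EH-property if there is $\epsilon>0$ such that every tournament $T$ containing no member of $\mathcal{H}$ as a subtournament contains a transitive subtournament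 on at least $|T|^{\epsilon}$ vertices. *)

(* Defs.v *)
(* Thresholds and exponents live in an arbitrary [R : realType]. *)
From mathcomp Require Import all_boot all_order all_algebra.
From mathcomp Require Import all_classical all_reals all_analysis.

Set Implicit Arguments.
Unset Strict Implicit.
Unset Printing Implicit Defensive.

Import Order.TTheory GRing.Theory Num.Theory.
Local Open Scope ring_scope.

Record tournament := Tournament {
  vert :> finType;
  arc : rel vert;
  arc_irr : irreflexive arc;
  arc_tour : forall x y : vert, x != y -> arc x y (+) arc y x
}.

Section Tournaments.
Variable T : tournament.
Implicit Types A B X Y : {set T}.

(* The subtournament induced on A has no directed cycle. *)
Definition transitive_sub A : Prop :=
  forall p : seq T, p != [::] -> {subset p <= A} -> ~ ucycle (@arc T) p.

Definition tr : nat := \max_(A : {set T} | `[< transitive_sub A >]) #|A|.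

Definition complete_to X Y : bool :=
  [forall x in X, forall y in Y, arc x y].

Definition num_arcs X Y : nat :=
  #|[set e : T * T | [&& e.1 \in X, e.2 \in Y & arc e.1 e.2]]|.

(* Meaningful for nonempty X and Y; it is 0 if one of them is empty. *)
Definition density (R : realType) X Y : R :=
  (num_arcs X Y)%:R / (#|X|%:R * #|Y|%:R).

End Tournaments.

(* phi is an isomorphism from H onto the subtournament of T induced on the
   image of phi. *)
Definition embedding (H T : tournament) (phi : H -> T) : Prop :=
  injective phi /\ forall a b : H, arc (phi a) (phi b) = arc a b.

Definition contains (T H : tournament) : Prop :=
  exists phi : H -> T, embedding phi.

(* Number of ones among the first i entries of v. *)
Definition zeta (n : nat) (v : n.-tuple bool) (i : nat) : nat :=
  count id (take i v).

(* The number of blocks prescribed for the set of index i when v(i) = 1: with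
   indices starting from 1 this is eta(zeta^v(i)), whence the shifts. *)
Definition num_blocks (n : nat) (v : n.-tuple bool)
    (eta : (zeta v n).-tuple nat) (i : 'I_n) : nat :=
  nth 0%N eta (zeta v i.+1).-1.

Definition long_length (n : nat) (v : n.-tuple bool)
    (eta : (zeta v n).-tuple nat) : nat :=
  (count negb v + \sum_(e <- eta) e)%N.

(* A sequence S_1, ..., S_n together with the chosen blocks S_{i,1}, S_{i,2},
   ... of each S_i; the blocks are irrelevant for the i with v(i) = 0. *)
Record mseq_data (T : tournament) (n : nat) := MseqData {
  mset : 'I_n -> {set T};
  blocks : 'I_n -> seq {set T}
}.

Section MSequences.
Variables (R : realType) (T : tournament) (n : nat).
Variables (v : n.-tuple bool) (eta : (zeta v n).-tuple nat).
Implicit Types chi : mseq_data T n.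

(* Parameters are meant to satisfy 0 < c and 0 <= lambda < 1. *)
Definition is_mseq (c lambda : R) chi : Prop :=
  [/\ forall i j : 'I_n, i != j -> [disjoint mset chi i & mset chi j],
      forall i : 'I_n, tnth v i ->
        [/\ transitive_sub (mset chi i),
            size (blocks chi i) = num_blocks eta i,
            mset chi i = \bigcup_(B <- blocks chi i) B,
            pairwise (fun A B : {set T} => [disjoint A & B] && complete_to A B)
              (blocks chi i) &
            forall B : {set T}, B \in blocks chi i ->
              c * (tr T)%:R <= #|B|%:R],
      forall i : 'I_n, ~~ tnth v i -> c * #|T|%:R <= #|mset chi i|%:R &
      forall i j : 'I_n, (i < j)%N ->
        1 - lambda <= density R (mset chi i) (mset chi j)].

Definition long_rep chi : seq {set T} :=
  flatten [seq if tnth v i then blocks chi i else [:: mset chi i]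
          | i <- enum 'I_n].

Definition mseq_vert chi : {set T} := \bigcup_(i < n) mset chi i.

Definition is_strong_pair (c : R) chi (A B : {set T}) : Prop :=
  [/\ [disjoint A & B],
      A \subset mseq_vert chi /\ B \subset mseq_vert chi,
      c * #|T|%:R <= #|A|%:R,
      c * #|T|%:R <= #|B|%:R \/
        (transitive_sub B /\ c * (tr T)%:R <= #|B|%:R) &
      density R A B = 1 \/ density R B A = 1].

End MSequences.

(* The tournaments T are required to have a vertex: otherwise all thresholds
   vanish and, e.g., for n = 1 the empty set is an m-sequence of the null
   tournament, so that the property would fail for trivial reasons. *)
Definition strong_EH_property (R : realType) (m : nat) (Hs : 'I_m -> tournament)
    (n : nat) (v : n.-tuple bool) (eta : (zeta v n).-tuple nat)
    (F : forall i : 'I_m, Hs i -> 'I_(long_length eta)) : Prop :=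
  forall c1 : R, 0 < c1 ->
  exists lambda0 c2 : R, [/\ 0 < lambda0, 0 < c2 &
    forall (T : tournament) (lambda : R) (chi : mseq_data T n),
      (0 < #|T|)%N -> 0 <= lambda -> lambda < 1 -> lambda <= lambda0 ->
      is_mseq eta c1 lambda chi ->
      (exists (i : 'I_m) (x : Hs i -> T),
         (forall h : Hs i, x h \in nth finset.set0 (long_rep v chi) (F i h)) /\
         embedding x)
      \/ (exists A B : {set T}, is_strong_pair c2 chi A B)].

Definition EH_property (R : realType) (m : nat) (Hs : 'I_m -> tournament) :
    Prop :=
  exists eps : R, 0 < eps /\
    forall T : tournament, (forall i : 'I_m, ~ contains T (Hs i)) ->
      exists A : {set T}, transitive_sub A /\ #|T|%:R `^ eps <= #|A|%:R.

Definition satisfies_EH (R : realType) (H : tournament) : Prop :=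
  exists eps : R, 0 < eps /\
    forall T : tournament, ~ contains T H ->
      exists A : {set T}, transitive_sub A /\ #|T|%:R `^ eps <= #|A|%:R.

(* Main.v *)
Require Import Defs.
From mathcomp Require Import all_boot all_order all_algebra.
From mathcomp Require Import all_classical all_reals all_analysis.
From mathcomp Require Import lra zify.

(* Write tr(Z) for the largest transitive subset of Z. If T is a counterexample
   to the EH-property for a small exponent, then a minimal vertex set U with
   tr(U) < |U|^eps is stable: every Z in U with |Z| >= g |U| has
   tr(Z) >= (1 - g) tr(U), where g is as small as desired. A strong pair made
   of linear-size pieces of U would give a transitive set larger than tr(U), so
   it suffices to find an m-sequence in a subtournament of U of linear size.

   Since T omits H_1, greedy embedding yields, inside any large set, two linear
   sets A, B with almost all arcs going from A to B. Iterating inside B gives a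
   sequence S_1, ..., S_n; stability provides at each step, inside a linear set,
   a transitive subset of size about tr(U) that can be cut into blocks.

   The linear constant obtained this way depends on lambda, whereas the strong
   EH-property fixes c_1 before lambda. This is repaired by giving all the S_i
   with v(i) = 0 the same size q >= tr(U) / 2 and passing to the subtournament
   induced on q vertices and all the S_i: it has at most (2n+1)q vertices. *)

Section ErdosHajnal.
Set Implicit Arguments.
Unset Strict Implicit.
Unset Printing Implicit Defensive.
(* [Defs] is imported again because [path.arc] has shadowed [Defs.arc]. *)
Import Defs Order.TTheory GRing.Theory Num.Theory.
Local Open Scope ring_scope.

(** * Transitive sets and arc counts *)

Lemma arc_asym (T : tournament) (x y : T) : arc x y -> ~~ arc y x.
Proof.
move=> xy; have [e|ne] := eqVneq x y.
  by move: xy; rewrite e (arc_irr y).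
by have := arc_tour ne; rewrite xy; case: (arc y x).
Qed.

Lemma arcN (T : tournament) (x y : T) : x != y -> arc y x = ~~ arc x y.
Proof. by move=> /arc_tour; case: (arc x y); case: (arc y x). Qed.

(** A triple violating transitivity is a directed triangle; conversely, transitivity shrinks a
    directed cycle to a loop, which irreflexivity forbids. *)
Lemma transitive_subP (T : tournament) (A : {set T}) :
  transitive_sub A <-> {in A & &, transitive (@arc T)}.
Proof.
split=> [trA y x z yA xA zA xy yz | trA [//|x p] _ pA].
  have xNz : x != z.
    by apply: contraTneq yz => <-; apply: arc_asym.
  have xNy : x != y by apply: contraTneq xy => ->; rewrite arc_irr.
  have yNz : y != z by apply: contraTneq yz => ->; rewrite arc_irr.
  apply: contraT => Nxz; case: (trA [:: x; y; z]) => //.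
    by move=> u; rewrite !inE => /or3P[] /eqP->.
  by rewrite /ucycle /= xy yz arcN // Nxz !inE negb_or xNy xNz yNz.
case/andP=> /= cyc _.
have sub : all [in A] (x :: rcons p x).
  apply/allP => u; rewrite inE mem_rcons => ux; apply: pA.
  by move: ux; rewrite !inE orbA orbb.
have := cyc; rewrite -[path _ _ _]/(sorted _ (_ :: _)) (sorted_pairwise_in trA) //=.
rewrite all_rcons => /andP[/andP[]]; by rewrite arc_irr.
Qed.

Lemma transitive_subS (T : tournament) (A B : {set T}) :
  A \subset B -> transitive_sub B -> transitive_sub A.
Proof. by move=> sAB trB p p0 pA; apply: trB => // x /pA /(fintype.subsetP sAB). Qed.

Lemma transitive_subU (T : tournament) (A B : {set T}) :
  complete_to A B -> transitive_sub A -> transitive_sub B ->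
  transitive_sub (A :|: B).
Proof.
move=> /forall_inP AB /transitive_subP trA /transitive_subP trB.
have {}AB x y : x \in A -> y \in B -> arc x y by move=> /AB/forall_inP; apply.
apply/transitive_subP => y x z; rewrite !inE.
case/orP=> yS /orP[] xS /orP[] zS xy yz.
- exact: trA yz.
- exact: AB.
- by case/negP: (arc_asym (AB _ _ yS xS)).
- by case/negP: (arc_asym (AB _ _ yS xS)).
- by case/negP: (arc_asym (AB _ _ zS yS)).
- exact: AB.
- by case/negP: (arc_asym (AB _ _ zS yS)).
- exact: trB yz.
Qed.

(** This is [tr] of the subtournament induced on [A], as [tr_induced] shows, but it stays in the
    vertex type of [T], so that nested sets compare directly. *)
Definition tr_in (T : tournament) (A : {set T}) : nat :=
  \max_(B : {set T} | (B \subset A) && `[< transitive_sub B >]) #|B|.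

Lemma tr_in_setT (T : tournament) : tr T = tr_in [set: T].
Proof. by apply: eq_bigl => A; rewrite finset.subsetT. Qed.

Lemma tr_in_max (T : tournament) (A B : {set T}) :
  B \subset A -> transitive_sub B -> (#|B| <= tr_in A)%N.
Proof.
by move=> BA trB; apply: (@leq_bigmax_cond _ _ (fun B : {set T} => #|B|));
  rewrite BA; apply/asboolP.
Qed.

Lemma transitive_set0 (T : tournament) : transitive_sub (finset.set0 : {set T}).
Proof. by apply/transitive_subP => x y z; rewrite inE. Qed.

Lemma transitive_set1 (T : tournament) (x : T) :
  transitive_sub ([set x] : {set T})%SET.
Proof.
by apply/transitive_subP => a b c; rewrite !inE => /eqP-> /eqP-> /eqP->.
Qed.

Lemma tr_inP (T : tournament) (A : {set T}) :
  exists B : {set T}, [/\ B \subset A, transitive_sub B & #|B| = tr_in A].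
Proof.
have [|B] := @eq_bigmax_cond _
  [pred B : {set T} | (B \subset A) && `[< transitive_sub B >]] (fun B => #|B|).
  apply/card_gt0P; exists finset.set0; rewrite inE finset.sub0set.
  by apply/asboolP; apply: transitive_set0.
by rewrite inE => /andP[BA /asboolP trB] e; exists B.
Qed.

Lemma tr_inS (T : tournament) (A B : {set T}) :
  A \subset B -> (tr_in A <= tr_in B)%N.
Proof.
move=> AB; have [C [CA trC <-]] := tr_inP A.
by apply: tr_in_max => //; apply: fintype.subset_trans AB.
Qed.

Lemma tr_in_leq_card (T : tournament) (A : {set T}) : (tr_in A <= #|A|)%N.
Proof. by have [B [/subset_leq_card + _ <-]] := tr_inP A. Qed.

Lemma complete_disjoint (T : tournament) (A B : {set T}) :
  complete_to A B -> [disjoint A & B].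
Proof.
move=> /forall_inP AB; rewrite disjoint_subset; apply/fintype.subsetP => x xA.
rewrite inE; apply/negP => xB; have /forall_inP/(_ _ xB) := AB x xA.
by rewrite arc_irr.
Qed.

(** Optimal transitive sets of the two sides glue together. This superadditivity is what stable sets
    are played against. *)
Lemma tr_inU (T : tournament) (A B U : {set T}) :
  complete_to A B -> A \subset U -> B \subset U ->
  (tr_in A + tr_in B <= tr_in U)%N.
Proof.
move=> AB AU BU.
have [A' [A'A trA' <-]] := tr_inP A; have [B' [B'B trB' <-]] := tr_inP B.
have A'B' : complete_to A' B'.
  apply/forall_inP => x /(fintype.subsetP A'A) xA.
  apply/forall_inP => y /(fintype.subsetP B'B) yB.
  by have /forall_inP/(_ _ xA)/forall_inP/(_ _ yB) := AB.
have dj := complete_disjoint A'B'.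
have -> : (#|A'| + #|B'| = #|A' :|: B'|)%N.
  by apply/esym/eqP; rewrite (leq_card_setU A' B').2.
apply: tr_in_max; last exact: transitive_subU.
by rewrite finset.subUset (fintype.subset_trans A'A) ?(fintype.subset_trans B'B).
Qed.

Lemma num_arcs_sum (T : tournament) (X Y : {set T}) :
  num_arcs X Y = (\sum_(x in X) \sum_(y in Y) arc x y)%N.
Proof.
rewrite /num_arcs -sum1dep_card pair_big_dep /= [RHS]big_mkcond [LHS]big_mkcond /=.
apply: eq_bigr => -[x y] _ /=.
by case: (x \in X); case: (y \in Y); case: (arc x y).
Qed.

Lemma num_arcsC (T : tournament) (X Y : {set T}) : [disjoint X & Y] ->
  (num_arcs X Y + num_arcs Y X = #|X| * #|Y|)%N.
Proof.
move=> dXY; rewrite !num_arcs_sum [X in (_ + X)%N]exchange_big -big_split /=.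
rewrite -sum_nat_const; apply: eq_bigr => x xX.
rewrite -big_split -sum1_card; apply: eq_bigr => y yY /=.
have xy : x != y.
  by apply: contraTneq yY => <-; rewrite (disjointFr dXY).
by rewrite (arcN xy); case: (arc x y).
Qed.

Lemma density_ge (R : realType) (T : tournament) (X Y : {set T}) (lam : R) :
  [disjoint X & Y] -> (0 < #|X|)%N -> (0 < #|Y|)%N ->
  (num_arcs Y X)%:R <= lam * (#|X|%:R * #|Y|%:R) -> 1 - lam <= density R X Y.
Proof.
move=> dXY X0 Y0 le; have /(congr1 (fun n => n%:R : R)) := num_arcsC dXY.
rewrite natrD natrM => e; rewrite /density ler_pdivlMr ?mulr_gt0 ?ltr0n //.
by rewrite mulrBl mul1r; lra.
Qed.

Lemma density1_complete (R : realType) (T : tournament) (X Y : {set T}) :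
  [disjoint X & Y] -> density R X Y = 1 -> complete_to X Y.
Proof.
(* Division by zero gives density 0, so density 1 forces both sets to be nonempty. *)
move=> dXY d1; have XY0 : #|X|%:R * #|Y|%:R != 0 :> R.
  by apply/eqP => XY0; move: d1; rewrite /density XY0 invr0 mulr0 => /eqP;
    rewrite eq_sym oner_eq0.
have {}d1 : num_arcs X Y = (#|X| * #|Y|)%N.
  apply/eqP; rewrite -(eqr_nat R) natrM; apply/eqP.
  by rewrite -[LHS](divfK XY0) -/(density R X Y) d1 mul1r.
have /eqP := num_arcsC dXY; rewrite d1 -[eqbRHS]addn0 eqn_add2l => /eqP NYX.
apply/forall_inP => x xX; apply/forall_inP => y yY.
have xy : x != y.
  by apply: contraTneq yY => <-; rewrite (disjointFr dXY).
rewrite -[arc x y]negbK -(arcN xy); apply/negP => yx.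
move: NYX; rewrite num_arcs_sum => /eqP; rewrite sum_nat_eq0.
move=> /forall_inP/(_ _ yY); rewrite sum_nat_eq0 => /forall_inP/(_ _ xX).
by rewrite yx.
Qed.

(** Markov's inequality: fewer than half of the elements can exceed twice the average bound. *)
Lemma card_half_le (R : realType) (T : finType) (X : {set T}) (w : T -> nat)
    (mu : R) :
  (\sum_(x in X) w x)%N%:R <= mu * #|X|%:R ->
  #|X|%:R / 2 <= #|[set x in X | (w x)%:R <= 2 * mu]%SET|%:R :> R.
Proof.
move=> le; set G := finset _; rewrite leNgt; apply/negP => lt.
have GX : G \subset X by apply/fintype.subsetP => x; rewrite inE => /andP[].
have X0 : 0 < #|X|%:R :> R by have := ler0n R #|G|; lra.
have mu0 : 0 <= mu by rewrite -(pmulr_lge0 _ X0); apply: le_trans le; apply: ler0n.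
have : \sum_(x in X :\: G) 2 * mu <= \sum_(x in X) (w x)%:R.
  rewrite [X in _ <= X](big_setID G) /= ler_wpDl ?sumr_ge0 //.
  apply: ler_sum => x; rewrite !inE => /andP[+ xX].
  by rewrite xX -ltNge => /ltW.
rewrite sumr_const -(natr_sum R) -mulr_natl => le2.
have cD : #|X|%:R = #|G|%:R + #|X :\: G|%:R :> R.
  by rewrite -natrD (finset.cardsD X) (finset.setIidPr GX) subnKC // subset_leq_card.
(* For [mu = 0] the averaging only yields [0 <= 0]; but then [w] vanishes on [X], so [X :\: G] is
   empty. *)
have [mu00|mu00] := eqVneq mu 0.
  have /card_gt0P[x] : (0 < #|X :\: G|)%N by rewrite -(ltr0n R); lra.
  rewrite !inE => /andP[+ xX]; rewrite xX /= mu00 mulr0 => /negP[].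
  move: le; rewrite mu00 mul0r lern0 sum_nat_eq0 => /forall_inP/(_ _ xX)/eqP->.
  by [].
have : 0 < mu by rewrite lt_neqAle eq_sym mu00.
nra.
Qed.

(** * Almost complete sequences in H-free tournaments *)

Definition chunk (T : finType) (q : nat) (s : seq T) (a : nat) : {set T} :=
  [set x in take q (drop (a * q) s)]%SET.

Lemma card_chunk (T : finType) (q a : nat) (s : seq T) :
  uniq s -> (a.+1 * q <= size s)%N -> #|chunk q s a| = q.
Proof.
move=> us le; rewrite /chunk finset.cardsE.
have /card_uniqP-> : uniq (take q (drop (a * q) s)) by rewrite take_uniq ?drop_uniq.
rewrite size_takel // size_drop; lia.
Qed.

(** The chunk number is recovered from the position in [s]. Hence distinct chunks are disjoint, and
    chunks of a sorted list are ordered like their numbers. *)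
Lemma chunk_index (T : finType) (q a : nat) (s : seq T) (x : T) :
  uniq s -> x \in chunk q s a -> x \in s /\ (index x s %/ q)%N = a.
Proof.
rewrite inE => us xs; split; first by move: xs => /mem_take /mem_drop.
have {xs} [i lt_i <-] := nthP x xs; move: lt_i.
rewrite size_take_min size_drop leq_min => /andP[lt_iq lt_is].
rewrite nth_take // nth_drop index_uniq ?divnMDl ?divn_small ?addn0 //; lia.
Qed.

Lemma leq_card_bigcup_seq (I : eqType) (T : finType) (s : seq I)
    (A : I -> {set T}) :
  (#|(\bigcup_(i <- s) A i)%SET| <= \sum_(i <- s) #|A i|)%N.
Proof.
elim/big_rec2: _ => [|i m B _ le]; first by rewrite finset.cards0.
by apply: leq_trans (leq_card_setU _ _) _; rewrite leq_add2l.
Qed.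

Lemma num_arcs_out (T : tournament) (X Y : {set T}) :
  num_arcs X Y = (\sum_(x in X) #|[set y in Y | arc x y]%SET|)%N.
Proof.
rewrite num_arcs_sum; apply: eq_bigr => x _; rewrite -sum1dep_card.
by rewrite big_mkcondr /=; apply: eq_bigr => y _; case: (arc x y).
Qed.

Lemma num_arcs_in (T : tournament) (X Y : {set T}) :
  num_arcs X Y = (\sum_(y in Y) #|[set x in X | arc x y]%SET|)%N.
Proof.
rewrite num_arcs_sum exchange_big; apply: eq_bigr => y _; rewrite -sum1dep_card.
by rewrite big_mkcondr /=; apply: eq_bigr => x _; case: (arc x y).
Qed.

Lemma num_arcs_out_le (R : realType) (T : tournament) (X Y : {set T}) (w : R) :
  {in X, forall x, #|[set y in Y | arc x y]%SET|%:R <= w} ->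
  (num_arcs X Y)%:R <= w * #|X|%:R.
Proof.
move=> le; rewrite num_arcs_out natr_sum (le_trans (ler_sum _ le)) //.
by rewrite sumr_const mulr_natr.
Qed.

Lemma num_arcs_in_le (R : realType) (T : tournament) (X Y : {set T}) (w : R) :
  {in Y, forall y, #|[set x in X | arc x y]%SET|%:R <= w} ->
  (num_arcs X Y)%:R <= w * #|Y|%:R.
Proof.
move=> le; rewrite num_arcs_in natr_sum (le_trans (ler_sum _ le)) //.
by rewrite sumr_const mulr_natr.
Qed.

(* If no vertex of the first candidate set keeps a [lam]-fraction of all the
   other candidate sets, then by pigeonhole one of these is sparse to a
   [1 / k]-fraction of the first. *)
Lemma greedy_embedding (R : realType) (H : tournament) (lam : R) (k : nat) :
  0 < lam -> exists2 c : R, 0 < c &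
  forall (T : tournament) (x0 : T) (s : seq H) (C : H -> {set T}) (M : R),
    size s = k -> uniq s -> 0 < M -> {in s, forall h, M <= #|C h|%:R} ->
    (exists phi : H -> T, {in s &, forall a b, arc (phi a) (phi b) = arc a b} /\
       {in s, forall a, phi a \in C a}) \/
    (exists h h' (A B : {set T}), [/\ [/\ h \in s, h' \in s & h != h'],
       A \subset C h, B \subset C h' &
       [/\ c * M <= #|A|%:R, c * M <= #|B|%:R &
         (num_arcs B A)%:R <= lam * (#|A|%:R * #|B|%:R)]]).
Proof.
move=> lam0; elim: k => [|k [c c0 IH]].
  by exists 1 => // T x0 s C M /size0nil-> _ M0 _; left; exists (fun=> x0).
have k0 : 0 < k.+1%:R :> R by rewrite ltr0n.
(* The first term absorbs the shrinking of the candidate sets by [lam] in the induction; the second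
   serves the pigeonhole over the [k] other sets, with one extra unit making it strict. *)
pose c' := Num.min (c * lam) (k.+1%:R^-1).
have c'0 : 0 < c' by rewrite /c' lt_min mulr_gt0 //= invr_gt0.
have c'c : c' <= c * lam by rewrite /c' ge_min lexx.
have c'k : c' * k.+1%:R <= 1 by rewrite -ler_pdivlMr // div1r /c' ge_min lexx orbT.
have c'1 : c' <= 1 by apply: le_trans c'k; rewrite ler_peMr ?(ltW c'0) // ler1n.
exists c' => // T x0 [//|h s] C M [size_s] /= /andP[hNs us] M0 leC.
have hC : M <= #|C h|%:R by apply: leC; rewrite mem_head.
have sC : {in s, forall h', M <= #|C h'|%:R}.
  by move=> h' h's; apply: leC; rewrite inE h's orbT.
have sh : {in s, forall h', h != h'}.
  by move=> h' h's; apply: contraNneq hNs => ->.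
(* These are the candidates for [h'] that remain once [h] is sent to [x]. *)
pose N x h' := [set y in C h' | if arc h h' then arc x y else arc y x]%SET.
have NC x h' : N x h' \subset C h' by apply/fintype.subsetP => y; rewrite inE => /andP[].
have [[x xC /allP xN]|bad] := pselect (exists2 x, x \in C h &
    all (fun h' => lam * #|C h'|%:R <= #|N x h'|%:R) s).
  have [||[phi [phi_arc phiN]]|[h1 [h2 [A [B]]]]] := IH T x0 s (N x) (lam * M) size_s us.
  - exact: mulr_gt0.
  - move=> h' h's; apply: le_trans (xN _ h's).
    by rewrite ler_pM2l // sC.
  - left; exists (fun a => if a == h then x else phi a).
    have sNh a : a \in s -> (a == h) = false by move=> /sh; rewrite eq_sym => /negbTE.
    have xphi a : a \in s -> arc x (phi a) = arc h a /\ arc (phi a) x = arc a h.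
      move=> a_s; have := phiN a a_s; rewrite inE (arcN (sh a a_s)) => /andP[_].
      by case: (arc h a) => [xa|ax]; rewrite ?xa ?ax (negbTE (arc_asym _)).
    split=> [a b|a]; rewrite !inE.
      case/orP=> [/eqP->|a_s] /orP[/eqP->|b_s]; rewrite ?eqxx ?sNh //.
      - by rewrite !arc_irr.
      - by case: (xphi b).
      - by case: (xphi a).
      - exact: phi_arc.
    case/orP=> [/eqP->|a_s]; rewrite ?eqxx ?sNh //.
    by apply: (fintype.subsetP (NC x a)); apply: phiN.
  case=> -[h1s h2s h12] AN BN [A_ge B_ge le].
  have c'M : c' * M <= c * (lam * M) by rewrite mulrA ler_pM2r.
  right; exists h1, h2, A, B; split.
  - by rewrite !inE h1s h2s !orbT.
  - exact: fintype.subset_trans (NC x h1).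
  - exact: fintype.subset_trans (NC x h2).
  - by split=> //; apply: le_trans c'M _.
(* These are the choices of [x] spoiled by [h']. As every choice is spoiled, these sets cover [C h]
   and one of them is large. *)
pose F h' := [set x in C h | #|N x h'|%:R < lam * #|C h'|%:R]%SET.
have FC h' : F h' \subset C h by apply/fintype.subsetP => y; rewrite inE => /andP[].
have [h' h's F_ge] : exists2 h', h' \in s & c' * M <= #|F h'|%:R.
  apply: contrapT => F_lt; move: hC; apply/negP; rewrite -ltNge.
  have CF : C h \subset (\bigcup_(h' <- s) F h')%SET.
    apply/fintype.subsetP => x xC; apply: contrapT => /negP xNF; apply: bad.
    exists x => //; apply/allP => h' h's; rewrite leNgt; apply: contra xNF => xF.
    by rewrite finset.bigcup_seq; apply/finset.bigcupP; exists h' => //; rewrite inE xC.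
  apply: (@le_lt_trans _ _ (\sum_(h' <- s) #|F h'|)%N%:R).
    by rewrite ler_nat (leq_trans (subset_leq_card CF)) // leq_card_bigcup_seq.
  apply: (@le_lt_trans _ _ (\sum_(h' <- s) c' * M)).
    rewrite natr_sum big_seq [leRHS]big_seq; apply: ler_sum => h' h's.
    by rewrite leNgt; apply/negP => /ltW ?; apply: F_lt; exists h'.
  rewrite big_const_seq count_predT size_s iter_addr_0 -mulr_natl.
  apply: (@lt_le_trans _ _ (k.+1%:R * (c' * M))).
    by rewrite ltr_pM2r ?mulr_gt0 // ltr_nat.
  by rewrite mulrA [_ * c']mulrC ler_piMl // ltW.
have h'M := sC h' h's.
have c'M : c' * M <= #|C h'|%:R by apply: le_trans h'M; rewrite ler_piMl // ltW.
have FN x : x \in F h' -> #|N x h'|%:R <= lam * #|C h'|%:R.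
  by rewrite inE => /andP[_ /ltW].
(* Between [F h'] and [C h'] the arcs oriented as between [h] and [h'] are rare, so the orientation
   in [H] decides which set comes first. *)
right; have [hh'|Nhh'] := boolP (arc h h').
  exists h', h, (C h'), (F h'); split=> //.
    by rewrite !inE eqxx h's orbT eq_sym sh.
  split=> //; rewrite mulrA; apply: num_arcs_out_le => x /FN.
  by rewrite /N hh'.
exists h, h', (F h'), (C h'); split=> //.
  by rewrite !inE eqxx h's orbT sh.
split=> //; rewrite [_%:R * _]mulrC mulrA; apply: num_arcs_in_le => x /FN.
by rewrite /N (negbTE Nhh').
Qed.

(** Injectivity is automatic: two distinct vertices are joined by an arc, and their images would
    otherwise carry a loop. *)
Lemma contains_of_arcs (T H : tournament) (phi : H -> T) :
  (forall a b, arc (phi a) (phi b) = arc a b) -> contains T H.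
Proof.
move=> phi_arc; exists phi; split=> // a b eq_phi; apply/eqP; apply: contraT => ab.
by have := arc_tour ab; rewrite -!phi_arc eq_phi !arc_irr.
Qed.

(** Disjoint chunks of [W], one for each vertex of [H], serve as candidate sets; the embedding is
    excluded, so the greedy procedure ends in a sparse pair. *)
Lemma near_complete_pair (R : realType) (H : tournament) (lam : R) :
  0 < lam -> exists c : R, [/\ 0 < c, c <= 1 &
  forall T : tournament, ~ contains T H -> forall W : {set T}, 1 <= c * #|W|%:R ->
    exists A B : {set T}, [/\ A \subset W, B \subset W, [disjoint A & B] &
      [/\ c * #|W|%:R <= #|A|%:R, c * #|W|%:R <= #|B|%:R &
         (num_arcs B A)%:R <= lam * (#|A|%:R * #|B|%:R)]]].
Proof.
move=> lam0; have [c0 c00 greedy] := @greedy_embedding R H lam #|H| lam0.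
pose h := #|H|.+1.
have h0 : 0 < h%:R :> R by rewrite ltr0n.
(* The bound [h%:R^-1] turns [1 <= c * #|W|%:R] into [h <= #|W|], so chunks are nonempty; the factor
   2 pays for rounding their size down. *)
pose c : R := Num.min (c0 / (2 * h%:R)) h%:R^-1.
have ch : c * h%:R <= 1 by rewrite -ler_pdivlMr // div1r /c ge_min lexx orbT.
have c_gt0 : 0 < c by rewrite /c lt_min divr_gt0 ?mulr_gt0 //= invr_gt0.
exists c; split=> //.
  by apply: le_trans ch; rewrite ler_peMr ?(ltW c_gt0) // ler1n.
move=> T HfreeT W W_ge.
have W0 : 0 < #|W|%:R :> R by rewrite -(pmulr_rgt0 _ c_gt0); apply: lt_le_trans W_ge.
have hW : (h <= #|W|)%N by rewrite -(ler_nat R); nra.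
have [x0 _] : exists x0, x0 \in W by apply/card_gt0P; rewrite -(ltr0n R).
pose q := (#|W| %/ h)%N.
have qW : #|W|%:R <= 2 * h%:R * q%:R :> R.
  rewrite -!natrM ler_nat /q -mulnA; have := divn_eq #|W| h.
  have := @ltn_pmod #|W| h isT; have : (0 < #|W| %/ h)%N by rewrite divn_gt0.
  nia.
have q0 : 0 < q%:R :> R by rewrite ltr0n divn_gt0.
pose C (a : H) := chunk q (enum W) (enum_rank a).
have C_q a : #|C a| = q.
  apply: card_chunk; first exact: enum_uniq.
  rewrite -cardE; apply: leq_trans (leq_trunc_div #|W| h).
  by rewrite mulnC leq_mul2l (leq_trans (ltn_ord _)) ?orbT // leqnSn.
have CW a : C a \subset W.
  by apply/fintype.subsetP => x /(chunk_index (enum_uniq _))[]; rewrite mem_enum.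
have disC a b : a != b -> [disjoint C a & C b].
  move=> ab; rewrite disjoint_subset; apply/fintype.subsetP => x.
  move=> /(chunk_index (enum_uniq _))[_ xa]; rewrite inE; apply: contra ab.
  move=> /(chunk_index (enum_uniq _))[_]; rewrite xa => /val_inj/enum_rank_inj->.
  by [].
have [||||[phi [phi_arc _]]|] := greedy T x0 (enum H) C q%:R.
- by rewrite -cardE.
- exact: enum_uniq.
- exact: q0.
- by move=> a _; rewrite C_q.
- by case: HfreeT; apply: (@contains_of_arcs _ _ phi) => a b; apply: phi_arc;
    rewrite mem_enum.
case=> a [b [A [B [[_ _ ab] AC BC [A_ge B_ge le]]]]].
have cq : c * #|W|%:R <= c0 * q%:R.
  apply: (@le_trans _ _ (c0 / (2 * h%:R) * (2 * h%:R * q%:R))).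
    by apply: ler_pM => //; rewrite ?(ltW c_gt0) // /c ge_min lexx.
  by rewrite mulrA divfK // mulf_neq0 // ?pnatr_eq0.
exists A, B; split.
- exact: fintype.subset_trans AC (CW a).
- exact: fintype.subset_trans BC (CW b).
- exact: disjointWl AC (disjointWr BC (disC a b ab)).
- by split=> //; apply: le_trans cq _.
Qed.

(* The back arcs are controlled vertex by vertex: once every vertex of [B']
   sends few arcs to the first set, so does every subset of [B'], and the rest
   of the sequence can be chosen inside [B'] whatever the sizes are. *)
Lemma near_complete_sequence (R : realType) (H : tournament) (lam : R) (n : nat) :
  0 < lam -> exists g : R, [/\ 0 < g, g <= 1 &
  forall T : tournament, ~ contains T H ->
  forall (Q : nat -> {set T} -> Prop) (W : {set T}), 1 <= g * #|W|%:R ->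
    (forall i (Z : {set T}), Z \subset W -> g * #|W|%:R <= #|Z|%:R ->
       exists2 X : {set T}, X \subset Z & Q i X) ->
    exists S : nat -> {set T},
      (forall i, (i < n)%N -> S i \subset W /\ Q i (S i)) /\
      (forall i j, (i < j)%N -> (j < n)%N -> [disjoint S i & S j] /\
         (num_arcs (S j) (S i))%:R <= lam * (#|S i|%:R * #|S j|%:R))].
Proof.
move=> lam0; elim: n => [|n [g [g0 g1 IH]]].
  by exists 1; split=> // T _ Q W _ _; exists (fun=> finset.set0).
(* Two cleanings follow, of [A] and then of [B]; each halves a set and doubles the density of back
   arcs, whence [lam / 4] and [c / 2]. *)
have [|c [c0 c1 pair]] := @near_complete_pair R H (lam / 4); first exact: divr_gt0.
have c20 : 0 < c / 2 by exact: divr_gt0.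
pose g' := c / 2 * g.
have g'0 : 0 < g' by rewrite mulr_gt0.
have g'c : g' <= c / 2 by rewrite /g' ler_piMr // ltW.
exists g'; split=> //; first by nra.
move=> T HfreeT Q W W_ge QW.
have W0 : 0 <= #|W|%:R :> R by exact: ler0n.
have [|A [B [AW BW dAB [A_ge B_ge le]]]] := pair T HfreeT W; first by nra.
(* Bounding the back arcs at each vertex of [A'] keeps them rare for whatever subset [X] the
   hypothesis [QW] returns. *)
pose wA x := #|[set y in B | arc y x]%SET|.
pose A' := [set x in A | (wA x)%:R <= 2 * (lam / 4 * #|B|%:R)]%SET.
have A'A : A' \subset A by apply/fintype.subsetP => x; rewrite inE => /andP[].
have A'_ge : #|A|%:R / 2 <= #|A'|%:R :> R.
  apply: card_half_le; rewrite -num_arcs_in -mulrA [#|B|%:R * _]mulrC.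
  exact: le.
have [||X XA' QX] := QW 0%N A'.
- exact: fintype.subset_trans AW.
- by apply: le_trans A'_ge; nra.
have BX : (num_arcs B X)%:R <= lam / 2 * #|X|%:R * #|B|%:R.
  apply: (@le_trans _ _ (2 * (lam / 4 * #|B|%:R) * #|X|%:R)); last by lra.
  by apply: num_arcs_in_le => x /(fintype.subsetP XA'); rewrite inE => /andP[].
pose wB y := #|[set x in X | arc y x]%SET|.
pose B' := [set y in B | (wB y)%:R <= 2 * (lam / 2 * #|X|%:R)]%SET.
have B'B : B' \subset B by apply/fintype.subsetP => x; rewrite inE => /andP[].
have B'_ge : #|B|%:R / 2 <= #|B'|%:R :> R.
  by apply: card_half_le; rewrite -num_arcs_out.
have gB' : g' * #|W|%:R <= g * #|B'|%:R.
  rewrite /g' mulrAC mulrC ler_pM2l //; apply: le_trans B'_ge; lra.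
have [||S [SW dS]] := IH T HfreeT (fun i => Q i.+1) B'.
- exact: le_trans gB'.
- move=> i Z ZB' Z_ge; apply: QW; last exact: le_trans Z_ge.
  exact: fintype.subset_trans ZB' (fintype.subset_trans B'B BW).
exists (fun i => if i is i'.+1 then S i' else X); split=> [[|i] lt_i|[|i] [|j] // lt_ij lt_j].
- by split=> //; apply: fintype.subset_trans XA' (fintype.subset_trans A'A AW).
- have [SiB' QSi] := SW i lt_i; split=> //.
  exact: fintype.subset_trans SiB' (fintype.subset_trans B'B BW).
- have [SjB' _] := SW j lt_j; split.
    apply: disjointWl (fintype.subset_trans XA' A'A) _.
    exact: disjointWr (fintype.subset_trans SjB' B'B) _.
  rewrite mulrA; apply: num_arcs_out_le => y /(fintype.subsetP SjB').
  by rewrite inE => /andP[_]; rewrite /wB => /le_trans; apply; lra.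
- exact: dS.
Qed.

(** * Blocks and induced subtournaments *)

Lemma exists_subset_card (T : finType) (A : {set T}) (q : nat) :
  (q <= #|A|)%N -> exists2 B : {set T}, B \subset A & #|B| = q.
Proof.
move=> qA; exists (chunk q (enum A) 0).
  by apply/fintype.subsetP => x /(chunk_index (enum_uniq _))[]; rewrite mem_enum.
by rewrite card_chunk ?enum_uniq // mul1n -cardE.
Qed.

(** Sorting [A] along its arcs and cutting the list into consecutive chunks makes each block
    complete to the later ones. *)
Lemma transitive_blocks (T : tournament) (A : {set T}) (k b : nat) :
  transitive_sub A -> (k * b <= #|A|)%N ->
  exists Bs : seq {set T}, [/\ size Bs = k,
    pairwise (fun B C : {set T} => [disjoint B & C] && complete_to B C) Bs,
    {in Bs, forall B : {set T}, B \subset A} &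
    {in Bs, forall B : {set T}, #|B| = b}].
Proof.
move=> /transitive_subP trA kb.
pose le (x y : T) := (x == y) || arc x y.
have le_total : {in A &, total le}.
  move=> x y _ _; rewrite /le; have [//|xy] := eqVneq x y.
  by rewrite (arcN xy); case: (arc x y).
have le_trans : {in A & &, transitive le}.
  move=> y x z yA xA zA; rewrite /le => /orP[/eqP-> //|xy] /orP[/eqP<-|yz].
    by rewrite xy orbT.
  by rewrite (trA y x z) ?orbT.
pose s := sort le (enum A).
have sA x : (x \in s) = (x \in A) by rewrite mem_sort mem_enum.
have us : uniq s by rewrite sort_uniq enum_uniq.
have size_s : size s = #|A| by rewrite size_sort -cardE.
have : sorted le s.
  by apply: (sort_sorted_in le_total); apply/allP => x; rewrite mem_enum.
rewrite (sorted_pairwise_in le_trans); last by apply/allP => x; rewrite sA.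
move=> ps; exists [seq chunk b s a | a <- iota 0 k]; split.
- by rewrite size_map size_iota.
- rewrite pairwise_map; have := iota_ltn_sorted 0 k; rewrite sorted_pairwise; last first.
    exact: ltn_trans.
  apply: sub_pairwise => a a' /= lt_a; rewrite andbC.
  suff cc : complete_to (chunk b s a) (chunk b s a') by rewrite cc complete_disjoint.
  apply/forall_inP => x /(chunk_index us)[xs xa]; apply/forall_inP => y.
  move=> /(chunk_index us)[ys ya].
  have lt_i : (index x s < index y s)%N.
    by rewrite ltnNge; apply/negP => /(leq_div2r b); rewrite xa ya leqNgt lt_a.
  have /(pairwiseP x)/(_ (index x s) (index y s)) := ps.
  rewrite !inE !index_mem !nth_index // => /(_ xs ys lt_i)/orP[/eqP xy|//].
  by rewrite xy ltnn in lt_i.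
- move=> _ /mapP[a _ ->]; apply/fintype.subsetP => x /(chunk_index us)[].
  by rewrite sA.
- move=> _ /mapP[a + ->]; rewrite mem_iota /= => lt_ak; apply: card_chunk => //.
  by rewrite size_s; apply: leq_trans kb; rewrite leq_mul2r lt_ak orbT.
Qed.

Definition induced (T : tournament) (Y : {set T}) : tournament :=
  @Tournament {x : T | x \in Y} (fun x y => arc (val x) (val y))
    (fun x => arc_irr (val x)) (fun x y xy => arc_tour (contra_neq (@val_inj _ _ _ x y) xy)).

Lemma contains_induced (T H : tournament) (Y : {set T}) :
  contains (induced Y) H -> contains T H.
Proof.
case=> phi [_ phi_arc]; exact: (@contains_of_arcs _ _ (val \o phi)).
Qed.

Definition restr (T : tournament) (Y S : {set T}) : {set induced Y} :=
  [set x | val x \in S]%SET.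

(** Both cardinalities and arc counts transfer to [induced Y] as instances of this one change of
    index. *)
Lemma sum_restr (T : tournament) (Y S : {set T}) (F : T -> nat) :
  S \subset Y ->
  (\sum_(x in restr Y S) F (val x) = \sum_(x in S) F x)%N.
Proof.
move=> /fintype.subsetP SY.
have e : ((val : induced Y -> T) @: restr Y S)%SET = S.
  apply/setP => x; apply/imsetP/idP => [[y + ->]|xS]; first by rewrite inE.
  by exists (exist _ x (SY x xS)); rewrite ?inE.
by rewrite -[in RHS]e big_imset // => x y _ _ /val_inj.
Qed.

Lemma card_restr (T : tournament) (Y S : {set T}) :
  S \subset Y -> #|restr Y S| = #|S|.
Proof. by move=> SY; rewrite -!sum1_card (sum_restr (fun=> 1%N)). Qed.

Lemma num_arcs_restr (T : tournament) (Y S S' : {set T}) :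
  S \subset Y -> S' \subset Y ->
  num_arcs (restr Y S) (restr Y S') = num_arcs S S'.
Proof.
move=> SY S'Y; rewrite !num_arcs_sum.
rewrite -(sum_restr (fun x => \sum_(y in S') arc x y)%N SY).
by apply: eq_bigr => x _; rewrite -(sum_restr (fun y => arc (val x) y : nat) S'Y).
Qed.

Lemma density_restr (R : realType) (T : tournament) (Y S S' : {set T}) :
  S \subset Y -> S' \subset Y ->
  density R (restr Y S) (restr Y S') = density R S S'.
Proof. by move=> SY S'Y; rewrite /density num_arcs_restr // !card_restr. Qed.

Lemma transitive_restr (T : tournament) (Y S : {set T}) :
  transitive_sub S -> transitive_sub (restr Y S).
Proof.
move=> /transitive_subP trS; apply/transitive_subP => y x z; rewrite !inE.
exact: trS.
Qed.

Lemma transitive_val (T : tournament) (Y : {set T}) (A : {set induced Y}) :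
  transitive_sub A -> transitive_sub ((val : induced Y -> T) @: A)%SET.
Proof.
move=> /transitive_subP trA; apply/transitive_subP => y x z.
by move=> /imsetP[y' y'A ->] /imsetP[x' x'A ->] /imsetP[z' z'A ->]; apply: trA.
Qed.

Lemma card_val (T : tournament) (Y : {set T}) (A : {set induced Y}) :
  #|((val : induced Y -> T) @: A)%SET| = #|A|.
Proof. by apply: card_imset; apply: val_inj. Qed.

Lemma tr_induced (T : tournament) (Y : {set T}) : tr (induced Y) = tr_in Y.
Proof.
rewrite tr_in_setT; apply/eqP; rewrite eqn_leq; apply/andP; split.
  have [A [_ trA <-]] := tr_inP [set: induced Y].
  rewrite -card_val tr_in_max //; last exact: transitive_val.
  by apply/fintype.subsetP => _ /imsetP[x _ ->]; apply: (valP x).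
have [A [AY trA <-]] := tr_inP Y.
by rewrite -(card_restr AY) tr_in_max ?finset.subsetT //; apply: transitive_restr.
Qed.

(** An entry 1 at [i] puts [zeta v i.+1] between 1 and [zeta v n], so the shifted index in
    [num_blocks] is in range and the default 0 is not reached. *)
Lemma num_blocks_mem (n : nat) (v : n.-tuple bool) (eta : (zeta v n).-tuple nat)
    (i : 'I_n) : tnth v i -> num_blocks eta i \in (eta : seq nat).
Proof.
move=> vi; apply: mem_nth; rewrite size_tuple.
have z_i : (0 < zeta v i.+1)%N.
  rewrite /zeta (take_nth false) ?size_tuple // -cats1 count_cat /=.
  by move: vi; rewrite (tnth_nth false) => ->; rewrite addn1.
have : (zeta v i.+1 <= zeta v n)%N.
  by rewrite /zeta -[take n v](cat_take_drop i.+1) count_cat take_takel ?leq_addr.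
lia.
Qed.

(** * Stable sets *)

Definition stable (R : realType) (T : tournament) (g : R) (U : {set T}) : Prop :=
  forall Z : {set T}, Z \subset U -> g * #|U|%:R <= #|Z|%:R ->
    (1 - g) * (tr_in U)%:R <= (tr_in Z)%:R.

Lemma stableW (R : realType) (T : tournament) (g g' : R) (U : {set T}) :
  g <= g' -> stable g U -> stable g' U.
Proof.
move=> gg' st Z ZU Z_ge; apply: (@le_trans _ _ ((1 - g) * (tr_in U)%:R)).
  by rewrite ler_wpM2r // lerD2l lerN2.
by apply: st => //; apply: le_trans Z_ge; rewrite ler_wpM2r.
Qed.

(** The larger of the two neighbourhoods of a vertex [x] has at least a quarter of [U]. Stability
    bounds its transitive number below, and adding [x] gains one, so the allowed loss [g * tr_in U]
    is at least 1. *)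
Lemma stable_tr_large (R : realType) (T : tournament) (g : R) (U : {set T}) :
  0 < g -> g <= 4^-1 -> (1 < #|U|)%N -> stable g U -> 1 <= g * (tr_in U)%:R.
Proof.
move=> g0 g4 U1 st; have /card_gt0P[x xU] : (0 < #|U|)%N by apply: ltnW.
pose No := [set y in U | arc x y]%SET; pose Ni := [set y in U | arc y x]%SET.
have NoU : No \subset U by apply/fintype.subsetP => y; rewrite inE => /andP[].
have NiU : Ni \subset U by apply/fintype.subsetP => y; rewrite inE => /andP[].
have xsU : [set x]%SET \subset U by rewrite finset.sub1set.
have tr1 : (0 < tr_in [set x]%SET)%N.
  by rewrite -[ltnLHS]/0%N -(finset.cards1 x) tr_in_max //; apply: transitive_set1.
have cU : (#|U| <= (#|No| + #|Ni|).+1)%N.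
  have -> : U = (x |: (No :|: Ni))%SET.
    apply/setP => y; rewrite !inE -andb_orr; have [->|yx] := eqVneq y x; first by [].
    by rewrite (arcN yx) orNb andbT.
  rewrite cardsU1; have := leq_card_setU No Ni => -[+ _]; by case: (_ \notin _) => /=; lia.
have key (Z : {set T}) : Z \subset U -> (tr_in [set x]%SET + tr_in Z <= tr_in U)%N ->
    (#|U| <= (2 * #|Z|).+1)%N -> 1 <= g * (tr_in U)%:R.
  move=> ZU trZ leZ; have : g * #|U|%:R <= #|Z|%:R.
    have : (#|U| <= 4 * #|Z|)%N by lia.
    rewrite -(ler_nat R) natrM => le4; apply: le_trans (_ : 4^-1 * #|U|%:R <= _).
      by rewrite ler_wpM2r.
    by rewrite mulrC ler_pdivrMr // mulrC.
  move=> /(st Z ZU); have : (tr_in Z)%:R + 1 <= (tr_in U)%:R :> R.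
    by rewrite -(natrD _ _ 1) ler_nat; lia.
  lra.
have [le|lt] := leqP #|Ni| #|No|.
  apply: (key No) => //; last by lia.
  apply: tr_inU => //; apply/forall_inP => _ /set1P->.
  by apply/forall_inP => y; rewrite inE => /andP[].
apply: (key Ni) => //; last by lia.
rewrite addnC; apply: tr_inU => //; apply/forall_inP => y.
by rewrite inE => /andP[_ yx]; apply/forall_inP => _ /set1P->.
Qed.

(** For use with [M = tr_in U] and at most [D] blocks: they must fit into a transitive set of size
    [M / 2], which is what large subsets of [U] are sure to contain. *)
Lemma block_size (M D : nat) : (0 < D)%N -> (2 * D <= M)%N ->
  exists b, [/\ (0 < b)%N, (D * b * 2 <= M)%N & (M <= 4 * D * b)%N].
Proof.
move=> D0 DM; exists (M %/ (2 * D))%N.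
have b0 : (0 < M %/ (2 * D))%N by rewrite divn_gt0 ?muln_gt0.
have lt_r : (M %% (2 * D) < 2 * D)%N by rewrite ltn_pmod ?muln_gt0.
have := divn_eq M (2 * D); move: b0 lt_r.
move: (M %/ (2 * D))%N (M %% (2 * D))%N => b r b0 lt_r eM.
split; nia.
Qed.

(* [c1] does not depend on [lam], although the sets of the sequence shrink with
   [lam]: the sets without blocks all have the same size, so they are large
   in the tournament that they span, and by stability the transitive number
   hardly drops on passing to that tournament. *)
Lemma exists_mseq (R : realType) (H : tournament) (n : nat) (v : n.-tuple bool)
    (eta : (zeta v n).-tuple nat) :
  (forall e : nat, e \in (eta : seq nat) -> (0 < e)%N) ->
  exists2 c1 : R, 0 < c1 & forall lam : R, 0 < lam ->
  exists g0 : R, [/\ 0 < g0, g0 <= 4^-1 &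
  forall (T : tournament) (U : {set T}) (g : R), ~ contains T H ->
    g <= g0 -> (1 < #|U|)%N -> stable g U ->
    exists (Y : {set T}) (chi : mseq_data (induced Y) n),
      [/\ Y \subset U, (0 < #|Y|)%N, g0 * #|U|%:R <= #|Y|%:R &
          is_mseq eta c1 lam chi]].
Proof.
move=> eta0.
have [D Dn0 etaD] : exists2 D, (0 < D)%N & {in (eta : seq nat), forall e, (e <= D)%N}.
  exists (\max_(e <- eta) e).+1 => // e ee.
  by apply: leqW; rewrite (big_rem e) //= leq_maxl.
have n0 : 0 < (2 * n + 1)%N%:R :> R by rewrite ltr0n addn1.
have D0 : 0 < D%:R :> R by rewrite ltr0n.
(* The two terms answer [#|Y| <= (2 * n + 1) * q] and [M <= 4 * D * b] below; neither involves
   [lam]. *)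
pose c1 : R := Num.min (2 * n + 1)%N%:R^-1 (4 * D%:R)^-1.
have c1_gt0 : 0 < c1 by rewrite lt_min !invr_gt0 n0 mulr_gt0.
have c1n : c1 * (2 * n + 1)%N%:R <= 1.
  by rewrite -ler_pdivlMr // div1r /c1 ge_min lexx.
have c1D : c1 * (4 * D%:R) <= 1.
  by rewrite -ler_pdivlMr ?mulr_gt0 // div1r /c1 ge_min lexx orbT.
exists c1 => // lam lam0.
have [g1 [g10 g11 seqS]] := @near_complete_sequence R H lam n lam0.
(* Half of [g1] leaves room for rounding [q] down, [4^-1] is for [stable_tr_large], and the last
   term forces [2 * D <= M]. *)
pose g0 : R := Num.min (g1 / 2) (Num.min 4^-1 (2 * D%:R)^-1).
have g00 : 0 < g0 by rewrite !lt_min !invr_gt0 divr_gt0 //= mulr_gt0 // ltr0n.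
have g0g1 : g0 <= g1 / 2 by rewrite /g0 ge_min lexx.
have g04 : g0 <= 4^-1 by rewrite /g0 !ge_min lexx orbT.
have g0D : g0 * (2 * D%:R) <= 1.
  by rewrite -ler_pdivlMr ?mulr_gt0 // div1r /g0 !ge_min lexx !orbT.
exists g0; split=> // T U g HfreeT gg0 U1 /(stableW gg0) {g gg0} st.
have M_ge := stable_tr_large g00 g04 U1 st; set M := tr_in U in M_ge.
have MU : M%:R <= #|U|%:R :> R by rewrite ler_nat tr_in_leq_card.
have g0U : 1 <= g0 * #|U|%:R by apply: le_trans M_ge _; rewrite ler_pM2l.
have [q /andP[q_le q_gt]] : exists q, q%:R <= g1 * #|U|%:R < q.+1%:R.
  by exists (Num.truncn (g1 * #|U|%:R)); apply: truncn_itv; rewrite mulr_ge0 // ltW.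
have q_ge : g0 * #|U|%:R <= q%:R by move: q_gt; rewrite -natr1; nra.
(* [Y0] keeps [Y] linear in [U] even if every entry of [v] is 1. Its stability also gives
   [M <= 2 * q], hence a size bound for all transitive sets. *)
have [|Y0 Y0U cY0] := @exists_subset_card _ U q.
  by rewrite -(ler_nat R); apply: le_trans q_le _; rewrite ler_piMl.
have trP (Z : {set T}) : Z \subset U -> g0 * #|U|%:R <= #|Z|%:R -> M%:R <= 2 * (tr_in Z)%:R :> R.
  move=> ZU /(st Z ZU); rewrite -/M => le.
  by have := ler0n R M; nra.
have M2q : (M <= 2 * q)%N.
  rewrite -(ler_nat R) natrM; apply: le_trans (trP Y0 Y0U _) _; first by rewrite cY0.
  by rewrite ler_pM2l // ler_nat -cY0 tr_in_leq_card.
have M2D : (2 * D <= M)%N.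
  rewrite -(ler_nat R) natrM -(ler_pM2l g00); exact: le_trans g0D M_ge.
have [b [b0 bM Mb]] := block_size Dn0 M2D.
pose isblocks (i : 'I_n) (X : {set T}) Bs := [/\ size Bs = num_blocks eta i,
  X = (\bigcup_(B <- Bs) B)%SET,
  pairwise (fun B C : {set T} => [disjoint B & C] && complete_to B C) Bs &
  {in Bs, forall B : {set T}, #|B| = b}].
pose Q (i : nat) (X : {set T}) := [/\ (0 < #|X|)%N, (#|X| <= 2 * q)%N &
  forall i' : 'I_n, i' = i :> nat ->
    if tnth v i' then transitive_sub X /\ exists Bs, isblocks i' X Bs
    else #|X| = q].
have q0 : (0 < q)%N by rewrite -(ltr0n R); nra.
have [||S [SU dS]] := seqS T HfreeT Q U.
- nra.
- move=> i Z ZU Z_ge; have [/existsP[i' /andP[/eqP <- vi]]|Nvi] :=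
    boolP [exists i' : 'I_n, (i' == i :> nat) && tnth v i']; last first.
    have [|X XZ cX] := @exists_subset_card _ Z q.
      by rewrite -(ler_nat R); apply: le_trans q_le _.
    exists X => //; split; rewrite ?cX ?leq_pmull //.
    move=> i' i'i; case: ifP => // vi'; case/negP: Nvi.
    by apply/existsP; exists i'; rewrite i'i eqxx vi'.
  have [L [LZ trL cL]] := tr_inP Z.
  have k_mem := num_blocks_mem eta vi; set k := num_blocks eta i' in k_mem.
  have k0 : (0 < k)%N := eta0 _ k_mem.
  have LM : (M <= 2 * #|L|)%N.
    rewrite -(ler_nat R) natrM cL; apply: trP => //; apply: le_trans Z_ge.
    by rewrite ler_wpM2r //; lra.
  have [|Bs [sBs pBs BsL cBs]] := @transitive_blocks T L k b trL.
    apply: leq_trans (leq_mul (etaD _ k_mem) (leqnn b)) _.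
    by rewrite -(leq_pmul2l (isT : (0 < 2)%N)) mulnC (leq_trans bM).
  have XL : (\bigcup_(B <- Bs) B)%SET \subset L.
    by rewrite finset.bigcup_seq; apply/finset.bigcupsP.
  (* The vertices of [L] left over by the cut are dropped, since the blocks must partition the
     set. *)
  exists (\bigcup_(B <- Bs) B)%SET; first exact: fintype.subset_trans LZ.
  split.
  + case: Bs sBs cBs {pBs BsL XL} => [e|B Bs _ cBs]; first by rewrite -e in k0.
    rewrite big_cons; apply: leq_trans (subset_leq_card (finset.subsetUl _ _)).
    by rewrite cBs ?mem_head.
  + apply: leq_trans (subset_leq_card XL) (leq_trans _ M2q).
    by rewrite cL tr_inS.
  + move=> i'' /val_inj->; rewrite vi; split; first exact: transitive_subS trL.
    by exists Bs.
pose Y := (Y0 :|: \bigcup_(i < n) S i)%SET.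
have SY (i : 'I_n) : S i \subset Y.
  by apply: fintype.subset_trans (finset.bigcup_sup i _) (finset.subsetUr _ _).
have YU : Y \subset U.
  rewrite finset.subUset Y0U; apply/finset.bigcupsP => i _.
  by case: (SU i (ltn_ord i)).
have qY : (q <= #|Y|)%N by rewrite -cY0 subset_leq_card // finset.subsetUl.
have Yq : (#|Y| <= (2 * n + 1) * q)%N.
  apply: leq_trans (leq_card_setU _ _) _; rewrite cY0 addnC mulnDl mul1n leq_add2r.
  apply: leq_trans (leq_card_bigcup_seq _ _) _.
  apply: (@leq_trans (\sum_(i < n) 2 * q)).
    by apply: leq_sum => i _; case: (SU i (ltn_ord i)) => _ [].
  by rewrite sum_nat_const card_ord mulnA [(n * 2)%N]mulnC.
have blocks_ex (i : 'I_n) : exists Bs, tnth v i -> isblocks i (S i) Bs.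
  have [_ [_ _ /(_ i erefl)]] := SU i (ltn_ord i).
  by case: (tnth v i) => [[_ [Bs BsP]]|_]; [exists Bs | exists [::]].
have [bl blP] := choice blocks_ex.
exists Y, (MseqData (fun i : 'I_n => restr Y (S i))
                    (fun i => [seq restr Y B | B <- bl i])).
split=> //; first exact: leq_trans qY.
  by apply: le_trans q_ge _; rewrite ler_nat.
have dSS (i j : 'I_n) : i != j -> [disjoint S i & S j].
  rewrite neq_ltn => /orP[] lt; first by case: (dS i j lt (ltn_ord j)).
  by rewrite disjoint_sym; case: (dS j i lt (ltn_ord i)).
split=> [i j ij|i vi|i /negbTE vi|i j ij] /=.
- have := dSS i j ij; rewrite !disjoint_subset => /fintype.subsetP sub.
  by apply/fintype.subsetP => x; rewrite !inE => /sub; rewrite inE.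
- have [_ [_ _ /(_ i erefl)]] := SU i (ltn_ord i); rewrite vi => -[trS _].
  have [sB eB pB cB] := blP i vi.
  have BY B : B \in bl i -> B \subset Y.
    move=> Bi; apply: fintype.subset_trans (SY i); rewrite eB finset.bigcup_seq.
    exact: finset.bigcup_sup.
  split.
  + exact: transitive_restr.
  + by rewrite size_map.
  + rewrite big_map; apply/setP => x; rewrite inE eB !finset.bigcup_seq.
    apply/finset.bigcupP/finset.bigcupP => -[B Bi]; rewrite ?inE => xB.
      by exists B => //; rewrite inE.
    by exists B.
  + rewrite pairwise_map; apply: sub_pairwise pB => B C /= /andP[dBC /forall_inP BC].
    apply/andP; split.
      move: dBC; rewrite !disjoint_subset => /fintype.subsetP sub.
      by apply/fintype.subsetP => x; rewrite !inE => /sub; rewrite inE.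
    apply/forall_inP => x; rewrite inE => /BC/forall_inP {}BC.
    by apply/forall_inP => y; rewrite inE => /BC.
  + move=> _ /mapP[B Bi ->]; rewrite card_restr ?BY // cB // tr_induced.
    apply: (@le_trans _ _ (c1 * M%:R)); first by rewrite ler_pM2l // ler_nat tr_inS.
    apply: (@le_trans _ _ (c1 * (4 * D%:R) * b%:R)); last by rewrite ler_piMl.
    by rewrite -!mulrA ler_pM2l // -!natrM ler_nat mulnA.
- have [_ [_ _ /(_ i erefl)]] := SU i (ltn_ord i); rewrite vi card_restr // => ->.
  rewrite card_sig; apply: (@le_trans _ _ (c1 * ((2 * n + 1) * q)%N%:R)).
    by rewrite ler_pM2l // ler_nat.
  by rewrite natrM mulrA ler_piMl.
- have [dij le] := dS i j ij (ltn_ord j); rewrite density_restr //.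
  by apply: density_ge => //; [have [_ []] := SU i (ltn_ord i) | have [_ []] := SU j (ltn_ord j)].
Qed.

(** * Strong pairs against stability *)

Lemma complete_val (T : tournament) (Y : {set T}) (A B : {set induced Y}) :
  complete_to A B ->
  complete_to ((val : induced Y -> T) @: A)%SET ((val : induced Y -> T) @: B)%SET.
Proof.
move=> /forall_inP AB; apply/forall_inP => _ /imsetP[x xA ->].
by apply/forall_inP => _ /imsetP[y yB ->]; have /forall_inP/(_ y yB) := AB x xA.
Qed.

(** A strong pair would give [(1 - g) * M] from one side and at least [(1 - g) * M] or
    [c2 * ((1 - g) * M)] from the other, more than [M] in total, where [M] is the transitive number
    of [U]. *)
Lemma no_stable_set (R : realType) (m : nat) (Hs : 'I_m -> tournament)
    (n : nat) (v : n.-tuple bool) (eta : (zeta v n).-tuple nat)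
    (F : forall i : 'I_m, Hs i -> 'I_(long_length eta)) :
  (0 < m)%N ->
  (forall e : nat, e \in (eta : seq nat) -> (0 < e)%N) ->
  strong_EH_property R F ->
  exists g : R, [/\ 0 < g, g <= 4^-1 &
  forall (T : tournament) (U : {set T}), (forall i, ~ contains T (Hs i)) ->
    (1 < #|U|)%N -> ~ stable g U].
Proof.
move=> m0 eta0 sEH.
have [c1 c10 mseqs] := @exists_mseq R (Hs (Ordinal m0)) n v eta eta0.
have [lam0 [c2 [lam00 c20 {}sEH]]] := sEH c1 c10.
pose lam := Num.min lam0 (2^-1 : R).
have lam_gt0 : 0 < lam by rewrite lt_min lam00 invr_gt0 ltr0n.
have lam_lt1 : lam < 1 by rewrite gt_min; apply/orP; right; lra.
have lam_le : lam <= lam0 by rewrite ge_min lexx.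
have [g0 [g00 g04 {}mseqs]] := mseqs lam lam_gt0.
(* Since [Y] has at least [g0 * #|U|] vertices, a [c2]-fraction of [Y] reaches the stability
   threshold. With [g0 <= 4^-1] one also gets [g <= c2 / 4], needed when [B] is only transitive. *)
pose g := Num.min g0 (c2 * g0).
have g_gt0 : 0 < g by rewrite lt_min g00 mulr_gt0.
have gg0 : g <= g0 by rewrite ge_min lexx.
have gc2 : g <= c2 * g0 by rewrite ge_min lexx orbT.
have g4 : g <= 4^-1 by apply: le_trans g04.
exists g; split=> // T U HsfreeT U1 st.
have [Y [chi [YU Y0 Y_ge chiP]]] := mseqs T U g (HsfreeT _) gg0 U1 st.
have M1 := stable_tr_large g_gt0 g4 U1 st; have {st} := st; rewrite /stable.
set M := (tr_in U)%:R in M1 * => st.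
have M0 : 0 < M by rewrite -(pmulr_rgt0 _ g_gt0); lra.
have cY : #|induced Y| = #|Y| by exact: card_sig.
have trY : (1 - g) * M <= (tr_in Y)%:R.
  by apply: st => //; apply: le_trans Y_ge; rewrite ler_wpM2r.
have Y0' : (0 < #|induced Y|)%N by rewrite cY.
have [[i [x [_ [_ x_arc]]]]|] :=
    sEH (induced Y) lam chi Y0' (ltW lam_gt0) lam_lt1 lam_le chiP.
  apply: (HsfreeT i); apply: (@contains_induced _ _ Y).
  exact: contains_of_arcs x_arc.
have valU (X : {set induced Y}) : ((val : induced Y -> T) @: X)%SET \subset U.
  by apply: fintype.subset_trans YU; apply/fintype.subsetP => _ /imsetP[x _ ->];
    apply: (valP x).
have large (X : {set induced Y}) : c2 * #|induced Y|%:R <= #|X|%:R ->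
    (1 - g) * M <= (tr_in ((val : induced Y -> T) @: X)%SET)%:R.
  rewrite cY => X_ge; apply: st; rewrite ?card_val //; apply: le_trans X_ge.
  apply: (@le_trans _ _ (c2 * (g0 * #|U|%:R))); last by rewrite ler_pM2l.
  by rewrite mulrA ler_wpM2r.
case=> A [B [dAB _ A_ge B_ge dens]].
have trA := large A A_ge.
have trB : (1 - g) * M <= (tr_in ((val : induced Y -> T) @: B)%SET)%:R \/
    c2 * ((1 - g) * M) <= (tr_in ((val : induced Y -> T) @: B)%SET)%:R.
  case: B_ge => [/large|[tB B_ge]]; [by left | right].
  apply: (@le_trans _ _ #|B|%:R).
    by apply: le_trans B_ge; rewrite tr_induced ler_pM2l.
  by rewrite ler_nat -card_val; apply: tr_in_max => //; apply: transitive_val.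
have : (tr_in ((val : induced Y -> T) @: A)%SET)%:R +
       (tr_in ((val : induced Y -> T) @: B)%SET)%:R <= M.
  rewrite -natrD ler_nat; case: dens => [/(density1_complete dAB)|dens].
    by move=> /complete_val cAB; apply: tr_inU.
  have /complete_val cBA : complete_to B A.
    by apply: density1_complete dens; rewrite disjoint_sym.
  by rewrite addnC; apply: tr_inU.
have gM : g * M <= M / 4 by nra.
have gcM' : c2 * (g * M) <= c2 * (M / 4) by rewrite ler_pM2l.
have gcM : g * M <= c2 * M / 4 by nra.
have cM : 0 < c2 * M by exact: mulr_gt0.
case: trB; lra.
Qed.

(** * The exponent and the polynomial bound *)

Lemma exists_powR_ge (R : realType) (a : R) :
  0 < a -> a <= 1 -> exists2 eps : R, 0 < eps & 1 - a <= a `^ eps.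
Proof.
move=> a0 a1; have l0 : ln a <= 0 by exact: ln_le0.
have l1 : 0 < 1 - ln a by lra.
(* By [1 + x <= expR x] it suffices that [eps * ln a >= - a], which this quotient satisfies. *)
exists (a / (1 - ln a)); first exact: divr_gt0.
have -> : a `^ (a / (1 - ln a)) = expR (ln a * (a / (1 - ln a))).
  by rewrite expRM lnK.
apply: le_trans (expR_ge1Dx _); rewrite lerD2l.
rewrite mulrA ler_pdivlMr //; nra.
Qed.

(** Induction on the size of [U]. If [U] fails, a proper subset [Z] with at least [g * #|U|]
    vertices has transitive number at least [(g * #|U|) ^ eps >= (1 - g) * #|U| ^ eps], so [U] would
    be stable. *)
Lemma tr_in_ge_powR (R : realType) (m : nat) (Hs : 'I_m -> tournament) (g eps : R) :
  0 < g -> 0 < eps -> 1 - g <= g `^ eps ->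
  (forall (T : tournament) (U : {set T}), (forall i, ~ contains T (Hs i)) ->
    (1 < #|U|)%N -> ~ stable g U) ->
  forall T : tournament, (forall i, ~ contains T (Hs i)) ->
  forall U : {set T}, #|U|%:R `^ eps <= (tr_in U)%:R.
Proof.
move=> g0 eps0 geps nostable T HsfreeT U.
have [k] := ubnP #|U|; elim: k U => // k IH U; rewrite ltnS => leUk.
have [U1|] := ltnP 1 #|U|; last first.
  case: (posnP #|U|) => [->|U0 U1]; first by rewrite powR0 ?gt_eqF.
  have /eqP/cards1P[x ->] : #|U| = 1%N by lia.
  rewrite finset.cards1 powR1 ler1n -[ltnLHS]/0%N -(finset.cards1 x).
  by apply: tr_in_max => //; apply: transitive_set1.
rewrite leNgt; apply/negP => /ltW lt_tr; apply: (nostable T U HsfreeT U1) => Z ZU Z_ge.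
have [->|ZnU] := eqVneq Z U.
  by rewrite ler_piMl // gerBl ltW.
have ltZU : (#|Z| < #|U|)%N by rewrite proper_card // finset.properEneq ZnU.
apply: le_trans (IH Z (leq_trans ltZU leUk)).
apply: (@le_trans _ _ (g `^ eps * #|U|%:R `^ eps)).
  apply: (@le_trans _ _ (g `^ eps * (tr_in U)%:R)); first by rewrite ler_wpM2r.
  by rewrite ler_wpM2l // powR_ge0.
rewrite -powRM ?(ltW g0) //; apply: ge0_ler_powR => //.
- exact: ltW.
- by rewrite nnegrE mulr_ge0 // ltW.
- by rewrite nnegrE.
Qed.

Lemma contains_trans (T H K : tournament) :
  contains T H -> contains H K -> contains T K.
Proof.
move=> [phi [phi_inj phi_arc]] [psi [psi_inj psi_arc]].
by exists (phi \o psi); split=> [|a b]; [apply: inj_comp | rewrite /= phi_arc].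
Qed.

End ErdosHajnal.

Theorem theorem7 (R : realType) (m : nat) (Hs : 'I_m -> tournament)
    (H : tournament) (n : nat) (v : n.-tuple bool)
    (eta : (zeta v n).-tuple nat)
    (F : forall i : 'I_m, Hs i -> 'I_(long_length eta)) :
  (0 < m)%N ->
  (forall i : 'I_m, contains (Hs i) H) ->
  (forall e : nat, e \in (eta : seq nat) -> (0 < e)%N) ->
  (forall i : 'I_m, injective (F i)) ->
  strong_EH_property R F ->
  EH_property R Hs /\ satisfies_EH R H.
Proof.
move=> m0 HsH eta0 _ sEH.
have [g [g0 g4 nostable]] := no_stable_set m0 eta0 sEH.
have [|eps eps0 geps] := exists_powR_ge g0; first by lra.
have EH : EH_property R Hs.
  exists eps; split=> // T HsfreeT.
  have [A [_ trA cA]] := tr_inP [set: T].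
  exists A; split=> //; rewrite cA -cardsT.
  exact: tr_in_ge_powR g0 eps0 geps nostable T HsfreeT [set: T].
(* The same exponent serves [H], since a tournament omitting [H] omits every member of the
   family. *)
split=> //; have [e [e0 eP]] := EH; exists e; split=> // T HfreeT.
by apply: eP => i Hsi; apply: HfreeT; apply: contains_trans Hsi (HsH i).
Qed.
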